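(* Let $\tilde\omega=((x,\tau),F,T,N)\in\tilde\Omega$ be a realization of the graphical construction that stabilizes. Suppose $\tilde\omega'=((x',\tau'),F',T',N')\in\tilde\Omega$ has the same envelopes and initial state as $\tilde\omega$, that is, $(x',\tau')=(x,\tau)$ and $F'=F$. Then $\tilde\omega'$ also stabilizes, at the same state: $\eta_\infty(\tilde\omega')=\eta_\infty(\tilde\omega)$. Moreover, $R_z(\tilde\omega')=R_z(\tilde\omega)$ for every site $z\in S$.
   Context: Graphical construction of activated random walks with finitely many particles on $S=\mathbb{Z}$ with nearest-neighbor jumps. This is a deterministic construction. $\tilde\Omega$ is the set of all $\tilde\omega=((x,\tau),F,T,N)$ such that, for some $m\ge 0$: $x=(x_1,\dots,x_m)\in S^m$ (initial particle positions), $\tau\in\{A,B\}^m$ (initial particle types, $A$ = passive, $B$ = active), $F=(F_{z,j})_{z\in S,j\in\mathbb{N}}\in\{-1,0,1\}^{S\times\mathbb{N}}$, $\mathbb{N}=\{1,2,\dots\}$ ($F_{z,j}$ is the $j$-th ''envelope'' at site $z$: $\pm1$ is a jump envelope, $0$ a sleep envelope), $T=(0=t_0<t_1<t_2<\cdots)$ with $t_i\uparrow\infty$, and $N=(n_1,n_2,\dots)\in\{1,\dots,m\}^{\mathbb{N}}$ is a sequence in which each symbol of $\{1,\dots,m\}$ appears infinitely many times. A state is $X=((x_n,\tau_n)_{n=1}^m,(j_z)_{z\in S})\in S^m\times\{A,B\}^m\times\mathbb{Z}_+^S$, where $x_n$ and $\tau_n$ are the position and type of particle $n$ and $j_z$ is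 the number of envelopes already burned at site $z$. For $\tilde n\in\{1,\dots,m\}$ define the state $\tilde n\cdot X$ as follows. If $\tau_{\tilde n}=A$, then $\tilde n\cdot X=X$. If $\tau_{\tilde n}=B$, put $\tilde x=x_{\tilde n}$, increase $j_{\tilde x}$ by one, and execute the envelope $F_{\tilde x,\tilde j}$, where $\tilde j$ is the new value of $j_{\tilde x}$: if $F_{\tilde x,\tilde j}=0$, the type of particle $\tilde n$ becomes $A$ if no other particle is located at $\tilde x$ and nothing else changes otherwise; if $F_{\tilde x,\tilde j}=\pm1$, particle $\tilde n$ moves to $\tilde x\pm1$ (remaining of type $B$) and all particles located at $\tilde x\pm1$ become of type $B$. Given $\tilde\omega$, let $X_0=((x,\tau),j\equiv0)$ and $X_i=n_i\cdot X_{i-1}$ for $i\ge1$. For a state $X$, $\eta[X]=(\eta^A(z),\eta^B(z))_{z\in S}$ where $\eta^A(z)$ (resp. $\eta^B(z)$) is the number of particles of type $A$ (resp. $B$) at $z$. The process is $\eta_t(\tilde\omega)=\eta[X_i]$ for $t\in[t_i,t_{i+1})$. $\tilde\omega$ stabilizes if there are $t_0$ and a configuration $\eta$ such that $\eta_t(\tilde\omega)=\eta$ for all $t\ge t_0$ and all particles are passive in $\eta$; then $\eta_\infty(\tilde\omega):=\eta$. $R_z(\tilde\omega)$ denotes the total number of jump envelopes burned (executed) at site $z$ during the whole evolution. *)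

(* Defs.v *)
From HB Require Import structures.
From mathcomp Require Import all_boot all_order all_algebra.
From mathcomp Require Import all_classical all_reals all_analysis.

Set Implicit Arguments.
Unset Strict Implicit.
Unset Printing Implicit Defensive.

Import Order.TTheory GRing.Theory Num.Theory.

Local Open Scope classical_set_scope.
Local Open Scope ring_scope.

Variant ptype := Passive | Active.

Definition is_active (a : ptype) : bool := if a is Active then true else false.

Definition ptype_of_bool (b : bool) : ptype := if b then Active else Passive.

Lemma is_activeK : cancel is_active ptype_of_bool.
Proof. by case. Qed.

HB.instance Definition _ := Equality.copy ptype (can_type is_activeK).

(* The m particles are indexed by 'I_m, i.e. by 0, ..., m - 1. The envelopes
   at a site z are indexed from 1: [envelope z 0] is never opened. Likewise
   [actor 0] is never used: the i-th action, at time [clock i], is carried out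
   by the particle [actor i], for i >= 1. *)
Record realization (R : realType) (m : nat) := Realization {
  init_pos : {ffun 'I_m -> int};
  init_type : {ffun 'I_m -> ptype};
  envelope : int -> nat -> int;
  envelopeP : forall z j, envelope z j \in [:: -1; 0; 1];
  clock : nat -> R;
  clock0 : clock 0 = 0;
  clock_incr : forall i, clock i < clock i.+1;
  clock_cvg : clock i @[i --> \oo] --> +oo;
  actor : nat -> 'I_m;
  actor_inf : forall (n : 'I_m) (k : nat), exists2 i, (k < i)%N & actor i = n
}.

Record state (m : nat) := State {
  pos : {ffun 'I_m -> int};
  typ : {ffun 'I_m -> ptype};
  burned : int -> nat
}.

Definition act_by (m : nat) (F : int -> nat -> int) (n : 'I_m) (X : state m) :
    state m :=
  if typ X n is Active then
    let z := pos X n in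
    let j := (burned X z).+1 in
    let burned' := fun y => if y == z then j else burned X y in
    let e := F z j in
    if e == 0 then
      let alone := [forall k : 'I_m, (k != n) ==> (pos X k != z)] in
      let typ' := [ffun k => if (k == n) && alone then Passive else typ X k] in
      State (pos X) typ' burned'
    else
      let pos' := [ffun k => if k == n then z + e else pos X k] in
      let typ' := [ffun k => if pos' k == z + e then Active else typ X k] in
      State pos' typ' burned'
  else X.

Fixpoint state_at (R : realType) (m : nat) (w : realization R m) (i : nat) :
    state m :=
  if i is i'.+1 then act_by (envelope w) (actor w i) (state_at w i')
  else State (init_pos w) (init_type w) (fun=> 0%N).

(* [(eta z).1] passive and [(eta z).2] active particles at the site z. *)
Definition config : Type := int -> nat * nat.

Definition config_of (m : nat) (X : state m) : config := fun z =>
  (#|[set n | (pos X n == z) && (typ X n == Passive)]%SET|,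
   #|[set n | (pos X n == z) && (typ X n == Active)]%SET|).

(* The index i such that clock i <= t < clock i.+1; it exists and is unique for
   t >= 0 (see [index_exists] and [configE]), and is 0 by convention for t < 0. *)
Definition index_at (R : realType) (m : nat) (w : realization R m) (t : R) :
    nat :=
  xget 0%N [set i | clock w i <= t < clock w i.+1].

Definition config_at (R : realType) (m : nat) (w : realization R m) (t : R) :
    config :=
  config_of (state_at w (index_at w t)).

Definition stabilizes_at (R : realType) (m : nat) (w : realization R m)
    (eta : config) : Prop :=
  (exists2 s : R, 0 <= s & forall t, s <= t -> config_at w t = eta) /\
  (forall z, (eta z).2 = 0%N).

Definition stabilizes (R : realType) (m : nat) (w : realization R m) : Prop :=
  exists eta, stabilizes_at w eta.

(* Meaningful only when [stabilizes w]; see [final_configE]. *)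
Definition final_config (R : realType) (m : nat) (w : realization R m) :
    config :=
  xget (fun=> (0%N, 0%N)) [set eta : config | stabilizes_at w eta].

(* Envelopes at z are burned in the order 1, 2, ..., so those burned in a
   state X are the ones with index j such that 1 <= j <= burned X z. The
   number is +oo when infinitely many jump envelopes are burned at z. *)
Definition jumps_burned (R : realType) (m : nat) (w : realization R m)
    (z : int) : \bar R :=
  counting [set j : nat | (exists i, (0 < j <= burned (state_at w i) z)%N) /\
                          envelope w z j != 0].

Lemma clock_homo (R : realType) (m : nat) (w : realization R m) :
  {homo clock w : i j / (i <= j)%N >-> i <= j}.
Proof.
apply: homo_leq => [i|y x z|i]; first exact: lexx; first exact: le_trans.
exact/ltW/clock_incr.
Qed.

Lemma index_exists (R : realType) (m : nat) (w : realization R m) (t : R) :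
  0 <= t -> exists i, clock w i <= t < clock w i.+1.
Proof.
move=> t0.
have ex : exists i, t < clock w i.
  have [N _ hN] := (cvgryPgt (clock w)).1 (clock_cvg w) t.
  by exists N; apply: hN => /=.
case: (ex_minnP ex) => -[|i] ti imin.
  by move: ti; rewrite clock0 ltNge t0.
exists i; rewrite ti andbT leNgt; apply/negP => /imin.
by rewrite ltnn.
Qed.

Lemma configE (R : realType) (m : nat) (w : realization R m) (i : nat) (t : R) :
  clock w i <= t < clock w i.+1 -> config_at w t = config_of (state_at w i).
Proof.
move=> ti; rewrite /config_at; congr (config_of (state_at w _)).
rewrite /index_at; apply: xget_unique => // j /andP[jt tj].
case/andP: ti => it ti.
have le_of a b : clock w a <= t -> t < clock w b.+1 -> (a <= b)%N.
  move=> ha hb; rewrite leqNgt; apply/negP => /(clock_homo w).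
  by rewrite leNgt (le_lt_trans ha hb).
by apply/eqP; rewrite eqn_leq !le_of.
Qed.

Lemma final_configE (R : realType) (m : nat) (w : realization R m)
  (eta : config) : stabilizes_at w eta -> final_config w = eta.
Proof.
move=> H; rewrite /final_config; apply: xget_unique => //= eta' [[s' _ h'] _].
case: H => -[s _ h] _.
by rewrite -(h (Num.max s s')) ?le_max ?lexx // (h' (Num.max s s')) // le_max lexx orbT.
Qed.

(* Main.v *)
Require Import Defs.
From mathcomp Require Import all_boot all_order all_algebra.
From mathcomp Require Import all_classical all_reals all_analysis.

(** Once the labels of the particles are forgotten, executing an envelope with
    a particle located at z depends on the site z only: it is the toppling of
    z, acting on pairs made of a configuration and of the numbers of burned
    envelopes ([site_state_act]). Topplings of two distinct sites that contain
    active particles commute ([topple_comm]), and neither makes the other one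
    illegal ([topple_legal]). At each site this comes down to the fact that the
    arrival of a particle, which wakes up everybody, commutes with a departure
    and with the execution of a sleep envelope.

    Legal toppling is therefore a reduction relation with the diamond property
    in exactly one step on each side. For such a relation, if some state reduces
    to a normal form in k steps, then every reduction from that state can be
    continued to this normal form, with k steps in total ([chain_descent]).
    Since every particle acts infinitely often, an evolution which has not
    reached a state without active particles always makes a further toppling
    ([next_action]); hence it reaches the normal form ([reach_normal]). The two
    realizations thus end with the same configuration and with the same numbers
    of burned envelopes at every site, and the latter determine the numbers of
    jumps. *)

Set Implicit Arguments.
Unset Strict Implicit.
Unset Printing Implicit Defensive.

Import Order.TTheory GRing.Theory Num.Theory.

Local Open Scope classical_set_scope.
Local Open Scope ring_scope.

(** * Reductions with the one-step diamond property *)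

Section Reduction.
Variables (T : Type) (step : T -> T -> Prop).

(** [chain k s t]: t is reached from s by exactly k steps. *)
Fixpoint chain (k : nat) (s t : T) : Prop :=
  if k is k'.+1 then exists2 u, step s u & chain k' u t else s = t.

Lemma chain_rcons k s t u : chain k s t -> step t u -> chain k.+1 s u.
Proof.
elim: k s => [|k IHk] s /=; first by move=> -> tu; exists u.
by move=> [v sv vt] tu; exists v => //; exact: IHk vt tu.
Qed.

Hypothesis diamond : forall s t u, step s t -> step s u ->
  t = u \/ exists2 v, step t v & step u v.

(** If a normal form is reached in k steps, then after any first step it can
    still be reached, in exactly k - 1 further steps. *)
Lemma chain_descent k s t u : (forall v, ~ step t v) ->
  chain k s t -> step s u -> exists2 k', k = k'.+1 & chain k' u t.
Proof.
move=> normal_t; elim: k s u => [|k IHk] s u /=.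
  by move=> -> /normal_t.
move=> [s1 ss1 s1t] su; exists k => //.
have [<-//|[v s1v uv]] := diamond ss1 su.
by have [k' -> vt] := IHk _ _ s1t s1v; exists v.
Qed.

End Reduction.

(** * Topplings *)

(** The local effects on the pair (passive, active) of a site: one active
    particle leaves, a particle arrives, or a sleep envelope is executed. For
    the last one, the particle is alone exactly when the site contains one
    particle in all, so that the test of [doze] only involves the total. *)
Definition depart (c : nat * nat) : nat * nat := (c.1, c.2.-1).
Definition arrive (c : nat * nat) : nat * nat := (0%N, (c.1 + c.2).+1).
Definition doze (c : nat * nat) : nat * nat :=
  if (c.1 + c.2 == 1)%N then (1%N, 0%N) else c.

(** A state in which the labels of the particles are forgotten: the
    configuration and the numbers of envelopes burned at each site. *)
Definition site_state : Type := (config * (int -> nat))%type.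

(** Effect at the site x of executing at z an envelope of content e. *)
Definition local_effect (e z x : int) (c : nat * nat) : nat * nat :=
  if e == 0 then if x == z then doze c else c
  else if x == z then depart c else if x == z + e then arrive c else c.

(** Execution of the next envelope at z by an active particle located there. *)
Definition topple (F : int -> nat -> int) (z : int) (s : site_state) :
    site_state :=
  (fun x => local_effect (F z (s.2 z).+1) z x (s.1 x),
   fun x => if x == z then (s.2 z).+1 else s.2 x).

(** The site z contains an active particle, which can be made to act. *)
Definition legal (z : int) (s : site_state) : Prop := (0 < (s.1 z).2)%N.

Definition toppling_step (F : int -> nat -> int) (s t : site_state) : Prop :=
  exists2 z, legal z s & t = topple F z s.

Lemma topple_legal F z z' s : z != z' -> legal z' s -> legal z' (topple F z s).
Proof.
rewrite /legal /topple /local_effect /= (eq_sym z) => /negPf ->.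
by case: ifP => // _; case: ifP => // _ /=; rewrite ltnS.
Qed.

Lemma arrive_depart c : (0 < c.2)%N -> arrive (depart c) = depart (arrive c).
Proof. by case: c => a [|b] //= _; rewrite /arrive /depart /= addnS. Qed.

Lemma arrive_doze c : (0 < c.2)%N -> arrive (doze c) = doze (arrive c).
Proof.
case: c => a [|b] //= _; rewrite /arrive /doze /= !addnS add0n !eqSS.
by case: eqP => [->|_] //=; rewrite addnS.
Qed.

Lemma local_effect_comm e e' z z' x c : z != z' ->
  (x == z -> 0 < c.2)%N -> (x == z' -> 0 < c.2)%N ->
  local_effect e z x (local_effect e' z' x c) =
  local_effect e' z' x (local_effect e z x c).
Proof.
rewrite /local_effect => zz'.
case: (eqVneq x z) => [->|xz] => [/(_ isT) c0 _|_].
  rewrite (negPf zz'); case: (e == 0); case: (e' == 0) => //; case: ifP => // _.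
    exact/esym/arrive_doze.
  exact/esym/arrive_depart.
case: (eqVneq x z') => [_ /(_ isT) c0|_ _].
  case: (e == 0); case: (e' == 0) => //; case: ifP => // _.
    exact: arrive_doze.
  exact: arrive_depart.
by case: (e == 0); case: (e' == 0) => //; do ?case: ifP.
Qed.

Lemma topple_comm F z z' s : z != z' -> legal z s -> legal z' s ->
  topple F z (topple F z' s) = topple F z' (topple F z s).
Proof.
move=> zz' lz lz'; rewrite /topple /= (negPf zz') eq_sym (negPf zz').
congr pair; apply/funext => x.
  by apply: local_effect_comm => // /eqP ->.
by case: (eqVneq x z) => // ->; rewrite (negPf zz').
Qed.

Lemma toppling_diamond F s t u :
  toppling_step F s t -> toppling_step F s u ->
  t = u \/ exists2 v, toppling_step F t v & toppling_step F u v.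
Proof.
move=> [z lz ->] [z' lz' ->]; have [->|zz'] := eqVneq z z'; first by left.
right; exists (topple F z (topple F z' s)).
  by exists z'; [exact: topple_legal|exact: topple_comm].
by exists z => //; apply: topple_legal; rewrite 1?eq_sym.
Qed.

(** * From labelled particles to topplings *)

Definition site_state_of (m : nat) (X : state m) : site_state :=
  (config_of X, burned X).

Section Projection.
Variable m : nat.
Implicit Types (X : state m) (n : 'I_m) (z : int).

Lemma config_ofE (p : {ffun 'I_m -> int}) (a : {ffun 'I_m -> ptype}) b z :
  config_of (State p a b) z =
  (#|[set n | (p n == z) && (a n == Passive)]%SET|,
   #|[set n | (p n == z) && (a n == Active)]%SET|).
Proof. by []. Qed.

Lemma config_of_total X z :
  ((config_of X z).1 + (config_of X z).2)%N =
  #|[set k | pos X k == z]%SET|.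
Proof.
rewrite /config_of /= -[RHS](cardsID [set k | typ X k == Passive]%SET).
by congr addn; apply: eq_card => k; rewrite !inE andbC; case: (typ X k) => //=;
  rewrite ?andbT ?andbF.
Qed.

Lemma legal_active X n : typ X n = Active -> legal (pos X n) (site_state_of X).
Proof.
by move=> Xn; apply/card_gt0P; exists n; rewrite inE eqxx Xn.
Qed.

Lemma legal_ex X z : legal z (site_state_of X) ->
  exists2 n, pos X n = z & typ X n = Active.
Proof. by move=> /card_gt0P[n]; rewrite inE => /andP[/eqP ? /eqP ?]; exists n. Qed.

Lemma aloneE X n :
  [forall k : 'I_m, (k != n) ==> (pos X k != pos X n)] =
  ((config_of X (pos X n)).1 + (config_of X (pos X n)).2 == 1)%N.
Proof.
rewrite config_of_total (cardsD1 n) inE eqxx eqSS cards_eq0.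
apply/forallP/eqP => [alone|/setP alone k].
  by apply/setP => k; rewrite !inE; have := alone k; case: (k != n) => //= /negPf.
by apply/implyP => kn; have := alone k; rewrite !inE kn /= => ->.
Qed.

Lemma config_of_sleep F n X : typ X n = Active ->
  F (pos X n) (burned X (pos X n)).+1 = 0 ->
  forall x, config_of (act_by F n X) x =
    if x == pos X n then doze (config_of X x) else config_of X x.
Proof.
move=> Xn Fe x; rewrite /act_by Xn Fe eqxx aloneE config_ofE.
set alone := (_ + _ == 1)%N.
case: (boolP alone) => [/[dup] tot1 | ntot1]; last first.
  have -> : (if x == pos X n then doze (config_of X x) else config_of X x) =
      config_of X x.
    by case: eqP => // ->; rewrite /doze -/alone (negPf ntot1).
  by congr pair; apply: eq_card => k; rewrite !inE ffunE andbF.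
rewrite /alone -aloneE => /forallP sole.
case: (eqVneq x (pos X n)) => [->|xn].
  rewrite /doze -/alone tot1; congr pair.
    rewrite -(cards1 n); apply: eq_card => k; rewrite !inE ffunE andbT.
    by have := sole k; case: eqVneq => [->|_ /= /negPf ->//]; rewrite !eqxx.
  apply: eq_card0 => k; rewrite !inE ffunE andbT.
  by have := sole k; case: eqVneq => [->|_ /= /negPf ->//]; rewrite eqxx.
by congr pair; apply: eq_card => k; rewrite !inE ffunE andbT;
  case: (eqVneq k n) => // ->; rewrite eq_sym (negPf xn).
Qed.

Lemma config_of_jump F n X (e := F (pos X n) (burned X (pos X n)).+1) :
  typ X n = Active -> e != 0 ->
  forall x, config_of (act_by F n X) x =
    if x == pos X n then depart (config_of X x)
    else if x == pos X n + e then arrive (config_of X x) else config_of X x.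
Proof.
move=> Xn e0 x; rewrite /act_by Xn -/e (negPf e0) config_ofE.
have ze : pos X n + e == pos X n = false.
  by rewrite -subr_eq0 addrC addKr (negPf e0).
have ez : pos X n == pos X n + e = false by rewrite eq_sym.
case: (eqVneq x (pos X n)) => [->|xn].
  rewrite /depart; congr pair.
    apply: eq_card => k; rewrite !inE !ffunE.
    case: (eqVneq k n) => [->|kn] /=; first by rewrite ze Xn andbF.
    by case: eqVneq => // ->; rewrite ez.
  rewrite /config_of /= [in RHS](cardsD1 n) inE eqxx Xn /=.
  apply: eq_card => k; rewrite !inE !ffunE.
  case: (eqVneq k n) => [->|kn] /=; first by rewrite ze.
  by case: eqVneq => // ->; rewrite ez.
case: (eqVneq x (pos X n + e)) => [xe|xe].
  rewrite /arrive config_of_total; congr pair.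
    by apply: eq_card0 => k; rewrite !inE !ffunE -xe; case: eqP.
  rewrite (cardsD1 n) inE !ffunE eqxx xe eqxx add1n; congr _.+1.
  apply: eq_card => k; rewrite !inE !ffunE.
  case: (eqVneq k n) => [->|kn] /=; first by rewrite ez.
  by case: eqP.
by congr pair; apply: eq_card => k; rewrite !inE !ffunE;
  (case: (eqVneq k n) => [->|kn] /=;
    [by rewrite !(eq_sym _ x) (negPf xn) (negPf xe)
    |by case: (eqVneq (pos X k) x) => // ->; rewrite (negPf xe)]).
Qed.

(** The action of an active particle is the toppling of its site: which of the
    particles at this site acts is irrelevant. *)
Lemma site_state_act F n X : typ X n = Active ->
  site_state_of (act_by F n X) = topple F (pos X n) (site_state_of X).
Proof.
move=> Xn; rewrite /site_state_of /topple /local_effect /=; congr pair.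
  apply/funext => x; case: (eqVneq (F _ _) 0) => e0.
    exact: config_of_sleep.
  exact: config_of_jump.
by rewrite /act_by Xn; case: ifP.
Qed.

Lemma act_by_step F n X : typ X n = Active ->
  toppling_step F (site_state_of X) (site_state_of (act_by F n X)).
Proof.
by move=> Xn; exists (pos X n); [exact: legal_active|exact: site_state_act].
Qed.

Lemma act_by_passive F n X : typ X n <> Active -> act_by F n X = X.
Proof. by rewrite /act_by; case: (typ X n). Qed.

(** The normal forms of legal toppling are the states in which all particles
    are passive. *)
Lemma normal_passive F X : (forall t, ~ toppling_step F (site_state_of X) t) <->
  (forall n, typ X n <> Active).
Proof.
split=> [normalX n Xn|passX t [z /legal_ex[n _ /passX]]//].
exact: normalX (act_by_step F Xn).
Qed.

End Projection.

(** * Evolutions *)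

Section Evolution.
Variables (R : realType) (m : nat).
Implicit Types (w : realization R m).

Lemma state_at_chain w i : exists k, chain (toppling_step (envelope w)) k
  (site_state_of (state_at w 0)) (site_state_of (state_at w i)).
Proof.
elim: i => [|i [k IHi]]; first by exists 0%N.
rewrite [state_at w i.+1]/=.
case: (pselect (typ (state_at w i) (actor w i.+1) = Active)).
  by move=> /(act_by_step (envelope w)) st; exists k.+1; exact: chain_rcons IHi st.
by move=> /act_by_passive ->; exists k.
Qed.

(** If a particle is active, then some active particle, not necessarily the
    same one, acts at some time on this very state. *)
Lemma next_action w i n : typ (state_at w i) n = Active ->
  exists i', state_at w i' = state_at w i /\
    typ (state_at w i') (actor w i'.+1) = Active.
Proof.
have [l il ln] := actor_inf w n i; rewrite -{}ln -(subnKC il) addSn.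
(* Induction on the waiting time d before the next action of n. *)
move: (l - i.+1)%N => d {il l n}.
elim: d i => [|d IHd] i; first by rewrite addn0; exists i.
case: (pselect (typ (state_at w i) (actor w i.+1) = Active)).
  by move=> act _; exists i.
move=> /(@act_by_passive _ (envelope w)) Xi.
by have := IHd i.+1; rewrite /= Xi addSnnS.
Qed.

(** The length of a reduction to the normal form bounds the number of topplings
    that the evolution can still make. *)
Lemma reach_normal w t k i :
  (forall v, ~ toppling_step (envelope w) t v) ->
  chain (toppling_step (envelope w)) k (site_state_of (state_at w i)) t ->
  exists i', site_state_of (state_at w i') = t.
Proof.
move=> normal_t; elim: k i => [|k IHk] i ch; first by exists i.
have [n Xn] : exists n, typ (state_at w i) n = Active.
  by case: ch => u [z /legal_ex[n _ Xn] _] _; exists n.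
have [i' [Xi' act]] := next_action Xn; rewrite -Xi' in ch.
have [_ [<-]] :=
  chain_descent (@toppling_diamond _) normal_t ch (act_by_step (envelope w) act).
exact: (IHk i'.+1).
Qed.

Lemma state_at_frozen w i j : (forall n, typ (state_at w i) n <> Active) ->
  (i <= j)%N -> state_at w j = state_at w i.
Proof.
move=> passX /subnKC <-; elim: (j - i)%N => [|d IHd]; first by rewrite addn0.
by rewrite addnS /= IHd act_by_passive.
Qed.

Lemma passive_stabilizes w i : (forall n, typ (state_at w i) n <> Active) ->
  stabilizes_at w (config_of (state_at w i)).
Proof.
move=> passX; split=> [|z]; last first.
  by apply: eq_card0 => n; rewrite !inE; have := passX n;
    case: (typ _ n) => //; rewrite andbF.
have clock_ge0 : 0 <= clock w i by rewrite -(clock0 w); exact: clock_homo.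
exists (clock w i) => // t it.
have [j jt] := index_exists w (le_trans clock_ge0 it).
rewrite (configE jt) (state_at_frozen passX) //; rewrite leqNgt; apply/negP.
move=> /(clock_homo w) ji; case/andP: jt => _.
by rewrite ltNge (le_trans ji it).
Qed.

Lemma stabilizes_passive w : stabilizes w ->
  exists i, forall n, typ (state_at w i) n <> Active.
Proof.
move=> [eta [[s _ etaE] eta0]]; exists (index_at w s) => n Xn.
have : (0 < (config_at w s (pos (state_at w (index_at w s)) n)).2)%N.
  exact: legal_active.
by rewrite etaE // eta0.
Qed.

Lemma burned_homo w z : {homo (fun i => burned (state_at w i) z) :
  i j / (i <= j)%N >-> (i <= j)%N}.
Proof.
apply: homo_leq => [//|y x v|i /=]; first exact: leq_trans.
rewrite /act_by; case: (typ _ _) => //=.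
by case: ifP => _ /=; case: eqP => // ->; exact: leqnSn.
Qed.

Lemma jumps_burned_passive w i z :
  (forall n, typ (state_at w i) n <> Active) ->
  jumps_burned w z = counting [set j : nat |
    (0 < j <= burned (state_at w i) z)%N /\ envelope w z j != 0].
Proof.
move=> passX; congr counting; apply/seteqP; split=> j [].
  move=> [l /andP[j0 jl]] Fj; split=> //; rewrite j0 (leq_trans jl) //.
  by rewrite -(state_at_frozen passX (leq_maxl i l)) burned_homo ?leq_maxr.
by move=> ji Fj; split=> //; exists i.
Qed.

End Evolution.

(** Only the envelopes of positive index are ever opened. *)
Lemma toppling_step_eq F F' :
  (forall z j, (0 < j)%N -> F' z j = F z j) -> toppling_step F' = toppling_step F.
Proof.
move=> FF'; apply/funext => s; apply/funext => t; apply/propext.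
by split=> -[z lz ->]; exists z; rewrite // /topple FF'.
Qed.

Theorem theorem1p2 (R : realType) (m : nat) (w w' : realization R m)
    (w_stab : stabilizes w)
    (eq_pos : init_pos w' = init_pos w)
    (eq_type : init_type w' = init_type w)
    (eq_env : forall (z : int) (j : nat),
        (0 < j)%N -> envelope w' z j = envelope w z j) :
  stabilizes w' /\
  final_config w' = final_config w /\
  (forall z : int, jumps_burned w' z = jumps_burned w z).
Proof.
(* The normal form is the site state of w at the index i; the reduction that
   leads to it is also one for the envelopes of w'. *)
have [i passX] := stabilizes_passive w_stab.
have [k ch] := state_at_chain w i.
have normalX : forall t,
    ~ toppling_step (envelope w') (site_state_of (state_at w i)) t.
  by apply/normal_passive.
have X0 : state_at w' 0 = state_at w 0 by rewrite /= eq_pos eq_type.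
rewrite -(toppling_step_eq eq_env) -X0 in ch.
have [i' XX'] := reach_normal normalX ch.
have passX' : forall n, typ (state_at w' i') n <> Active.
  by apply/(normal_passive (envelope w')); rewrite XX'.
have stab' := passive_stabilizes passX'.
case: XX' => conf burn.
split; first by exists (config_of (state_at w' i')).
split=> [|z].
  by rewrite (final_configE stab') (final_configE (passive_stabilizes passX)).
rewrite (jumps_burned_passive z passX) (jumps_burned_passive z passX') burn.
congr counting; apply/seteqP.
by split=> j [/andP[j0 jX] Fj]; split; rewrite ?j0 //; move: Fj; rewrite eq_env.
Qed.
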